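(* Let $T$ be a compact metric space, let $\mu$ be a regular, nonatomic, $\sigma$-additive measure on the Borel $\sigma$-algebra $\mathcal{B}$ of $T$ with values in $[0,\infty)$, and let $X$ be a Banach lattice with order-continuous norm. Let $f:T\to X$ be any (oH)-integrable function. Then there exist an $(o)$-sequence $(b_n)_n$ in $X$ and a corresponding sequence $(\gamma_n)_n$ of gages such that, for every $n$ and every $\gamma_n$-fine Henstock partition $\Pi$ of $T$, $$\sum_{E\in\Pi} Ob_n(f,E)\le b_n,$$ where, for each set $E$ of $\Pi$, $$Ob_n(f,E)=\sup_{\Pi'_E,\Pi''_E}\Big|\sum_{F''\in\Pi''_E} f(\tau_{F''})\mu(F'')-\sum_{F'\in\Pi'_E} f(\tau_{F'})\mu(F')\Big|,$$ the supremum (in $X$) being taken over all pairs $\Pi'_E,\Pi''_E$ of $\gamma_n$-fine Henstock partitions of $E$.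
   Context: Let $d$ be the metric of $T$. A gage is any map $\gamma:T\to(0,\infty)$. For a Borel set $A\subset T$ (in particular $A=T$), a Henstock partition of $A$ is a finite family $\Pi=\{(E_i,t_i): i=1,\dots,k\}$, where the $E_i$ are pairwise disjoint Borel sets with union $A$ and the tags satisfy $t_i\in E_i$. It is $\gamma$-fine if $d(w,t_i)<\gamma(t_i)$ for every $w\in E_i$ and every $i$. $E\in\Pi$ means that $E$ is one of the sets of $\Pi$, and $\tau_E$ denotes its tag. Put $\sigma(f,\Pi)=\sum_{E\in\Pi} f(\tau_E)\mu(E)$. An $(o)$-sequence in $X$ is a decreasing sequence $(b_n)_n$ with $\inf_n b_n=0$. A function $f:T\to X$ is (oH)-integrable if there exist $J\in X$, an $(o)$-sequence $(b_n)_n$ in $X$ and a sequence $(\gamma_n)_n$ of gages such that for every $n$ and every $\gamma_n$-fine Henstock partition $\Pi$ of $T$ one has $|\sigma(f,\Pi)-J|\le b_n$. *)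

(* Defs.v *)
From HB Require Import structures.
From mathcomp Require Import all_boot all_order all_algebra.
From mathcomp Require Import all_classical all_reals all_analysis.

Set Implicit Arguments.
Unset Strict Implicit.
Unset Printing Implicit Defensive.

Import Order.TTheory GRing.Theory Num.Theory.
Import numFieldNormedType.Exports.

Local Open Scope classical_set_scope.
Local Open Scope ring_scope.

(* MathComp's hierarchy has no structure joining lattices and modules, and none
   can be added below realDomainType; the mixin therefore carries the order
   itself, and the lattice instance is declared on the resulting structure. *)
HB.mixin Record CompleteNormedModule_isBanachLattice (R : realType) X
    & CompleteNormedModule R X := {
  bl_le : rel X ;
  bl_meet : X -> X -> X ;
  bl_join : X -> X -> X ;
  bl_le_refl : reflexive bl_le ;
  bl_le_anti : antisymmetric bl_le ;
  bl_le_trans : transitive bl_le ;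
  bl_lexI : forall x y z, bl_le x (bl_meet y z) = bl_le x y && bl_le x z ;
  bl_leUx : forall x y z, bl_le (bl_join x y) z = bl_le x z && bl_le y z ;
  bl_leD2r : forall z x y, bl_le x y -> bl_le (x + z) (y + z) ;
  bl_leZ2l : forall (a : R) x y, 0 <= a -> bl_le x y -> bl_le (a *: x) (a *: y) ;
  bl_le_norm : forall x y,
    bl_le (bl_join x (- x)) (bl_join y (- y)) -> `|x| <= `|y|
}.

#[short(type="banachLatticeType")]
HB.structure Definition BanachLattice (R : realType) :=
  {X of CompleteNormedModule R X & CompleteNormedModule_isBanachLattice R X}.

HB.instance Definition _ (R : realType) (X : banachLatticeType R) :=
  @Order.Le_isPOrder.Build ring_display X (@bl_le R X)
    (@bl_le_refl R X) (@bl_le_anti R X) (@bl_le_trans R X).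
HB.instance Definition _ (R : realType) (X : banachLatticeType R) :=
  @Order.POrder_MeetJoin_isLattice.Build ring_display X
    (@bl_meet R X) (@bl_join R X) (@bl_lexI R X) (@bl_leUx R X).

(* Measurable types are pointed, hence so are the metric spaces below. *)
#[short(type="pmetricType")]
HB.structure Definition PointedMetric (R : realType) :=
  {T of Metric R T & isPointed T}.

Notation borel T := (g_sigma_algebraType (@open T)).

Section banach_lattice.
Context {R : realType} {X : banachLatticeType R}.
Implicit Types (x : X) (D : set X) (b : nat -> X).

(* The lattice modulus |x|; the notation [`|x|] is the norm. *)
Definition modulus x : X := Order.join x (- x).

Definition order_continuous_norm :=
  forall D, D !=set0 ->
    (forall x y, D x -> D y -> exists2 z, D z & z <= x /\ z <= y) ->
    infimums D 0 -> infimums [set `|x| | x in D] 0.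

Definition o_sequence b :=
  nonincreasing_seq b /\ infimums (range b) 0.

End banach_lattice.
Arguments order_continuous_norm {R} X.

Section borel_measures.
Context {R : realType} {T : pmetricType R}.
Variable mu : {finite_measure set (borel T) -> \bar R}.

Definition regular_measure :=
  forall (A : set (borel T)) (e : R), measurable A -> 0 < e ->
    exists K U : set T,
      [/\ compact K, open U, K `<=` A, A `<=` U & (mu (U `\` K) < e%:E)%E].

Definition nonatomic :=
  forall A : set (borel T), measurable A -> (0 < mu A)%E ->
    exists B : set (borel T),
      [/\ measurable B, B `<=` A, (0 < mu B)%E & (mu B < mu A)%E].

End borel_measures.

Record tagged_family (T : Type) := TaggedFamily {
  ncells : nat ;
  cell : 'I_ncells -> set T ;
  tag_of : 'I_ncells -> T
}.
Arguments cell {T} _ _.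
Arguments tag_of {T} _ _.

Section henstock.
Context {R : realType} {T : pmetricType R}.
Implicit Types (A E : set T) (P : tagged_family T) (g : T -> R).

Definition henstock_partition A P :=
  [/\ forall i, measurable (cell P i : set (borel T)),
      trivIset setT (cell P),
      \bigcup_i cell P i = A &
      forall i, cell P i (tag_of P i)].

Definition gage g := forall t, 0 < g t.

Definition gage_fine g P :=
  forall i w, cell P i w -> mdist w (tag_of P i) < g (tag_of P i).

Context {X : banachLatticeType R}.
Variables (mu : {finite_measure set (borel T) -> \bar R}) (f : T -> X).

(* [fine] is the projection of extended reals to reals. *)
Definition riemann_sum P : X :=
  \sum_(i < ncells P) fine (mu (cell P i)) *: f (tag_of P i).

Definition oH_integrable :=
  exists (J : X) (b : nat -> X) (gamma : nat -> T -> R),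
    [/\ o_sequence b,
        forall n, gage (gamma n) &
        forall n P, henstock_partition setT P -> gage_fine (gamma n) P ->
          modulus (riemann_sum P - J) <= b n].

Definition oscillations g E : set X :=
  [set x | exists P' P'' : tagged_family T,
    [/\ henstock_partition E P' /\ gage_fine g P',
        henstock_partition E P'' /\ gage_fine g P'' &
        x = modulus (riemann_sum P'' - riemann_sum P')]].

(* [supremum 0] returns a default value when there is no supremum, so a
   statement about [Ob] has to assert [supremums (oscillations g E) !=set0]. *)
Definition Ob g E : X := supremum 0 (oscillations g E).

End henstock.

(* Main.v *)
(* For cells E_i of a fine partition of T, picking for each i two fine partitions
   of E_i and gluing them gives two fine partitions of T, so every choice of
   differences x_i of Riemann sums over E_i satisfies sum_i x_i <= 2 b_n.
   Suprema of sums of independent choices are sums of suprema, and the set of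
   differences over E_i is symmetric, so its supremum is Ob_n(f, E_i).
   The suprema exist because an order-continuous norm makes X Dedekind
   complete. *)
Require Import Defs.
From mathcomp Require Import all_boot all_order all_algebra.
From mathcomp Require Import all_classical all_reals all_analysis.

Import Order.TTheory GRing.Theory Num.Theory.
Import numFieldNormedType.Exports.

Local Open Scope classical_set_scope.
Local Open Scope ring_scope.

Set Implicit Arguments.
Unset Strict Implicit.
Unset Printing Implicit Defensive.

(** * Order arithmetic, moduli and norms in a Banach lattice *)

Section banach_lattice_order.
Context {R : realType} {X : banachLatticeType R}.
Implicit Types (x y z : X) (D : set X).

Lemma bl_lerD2r z x y : (x + z <= y + z) = (x <= y).
Proof.
apply/idP/idP => [h|]; last exact: (@bl_leD2r R X).
by have := @bl_leD2r R X (- z) _ _ h; rewrite !addrK.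
Qed.

Lemma bl_lerD x y z t : x <= y -> z <= t -> x + z <= y + t.
Proof.
move=> xy zt; apply: (@le_trans _ _ (y + z)); first by rewrite bl_lerD2r.
by rewrite ![y + _]addrC bl_lerD2r.
Qed.

Lemma bl_lerBrDr x y z : (x <= y - z) = (x + z <= y).
Proof. by rewrite -(bl_lerD2r z x) subrK. Qed.

Lemma bl_subr_ge0 x y : (0 <= y - x) = (x <= y).
Proof. by rewrite bl_lerBrDr add0r. Qed.

Lemma bl_lerN2 x y : (- x <= - y) = (y <= x).
Proof. by rewrite -[LHS]bl_subr_ge0 opprK addrC bl_subr_ge0. Qed.

Lemma bl_lerZ2l (a : R) x y : 0 < a -> (a *: x <= a *: y) = (x <= y).
Proof.
move=> a0; apply/idP/idP => [h|]; last exact/(@bl_leZ2l R X)/ltW.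
have := @bl_leZ2l R X a^-1 _ _ (ltW _) h.
by rewrite !scalerA mulVf ?gt_eqF// !scale1r; apply; rewrite invr_gt0.
Qed.

Lemma le_modulus x : x <= modulus x.
Proof. exact: leUl. Qed.

Lemma modulusN x : modulus (- x) = modulus x.
Proof. by rewrite /modulus opprK joinC. Qed.

Lemma modulus_le x y : (modulus x <= y) = (x <= y) && (- x <= y).
Proof. exact: leUx. Qed.

Lemma modulus_ge0 x : 0 <= modulus x.
Proof.
rewrite -(bl_lerZ2l _ _ (ltr0Sn R 1)) scaler0 scaler_nat mulr2n.
rewrite -(subrr x); apply: bl_lerD; first exact: le_modulus.
by rewrite -modulusN; exact: le_modulus.
Qed.

Lemma ge0_modulus x : 0 <= x -> modulus x = x.
Proof.
move=> x0; apply/eqP; rewrite eq_le le_modulus modulus_le lexx andbT /=.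
by apply: (le_trans _ x0); rewrite -oppr0 bl_lerN2.
Qed.

Lemma le_norm_modulus x y : modulus x <= modulus y -> `|x| <= `|y|.
Proof. exact: (@bl_le_norm R X). Qed.

(** This turns norm estimates back into order inequalities: if [x <= y], the positive part of [x]
    lies below [modulus y], so its norm is at most that of [y], hence below every [e]. *)
Lemma le0_norm_small x :
  (forall e : R, 0 < e -> exists2 y, x <= y & `|y| < e) -> x <= 0.
Proof.
move=> small; suff /eqP xp0 : `|Order.join x 0| == 0 :> R.
  by rewrite -(normr0_eq0 xp0) leUl.
rewrite eq_le normr_ge0 andbT; apply/ler_addgt0Pl => e e0.
rewrite addr0; have [y xy ye] := small _ e0.
apply/(le_trans _ (ltW ye))/le_norm_modulus.
rewrite ge0_modulus; last exact: leUr.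
by rewrite leUx modulus_ge0 (le_trans xy)// le_modulus.
Qed.

Lemma archimedean_le0 x y : (forall n, x *+ n.+1 <= y) -> x <= 0.
Proof.
move=> xy; apply: le0_norm_small => e e0.
(* Chosen so that [n.+1] exceeds the norm of [y] divided by [e]. *)
pose n := Num.truncn (`|y| / e).
exists (n.+1%:R^-1 *: y).
  rewrite -(@bl_lerZ2l n.+1%:R) ?ltr0Sn// scalerA mulfV ?pnatr_eq0//.
  by rewrite scale1r scaler_nat.
rewrite normrZ gtr0_norm ?invr_gt0 ?ltr0Sn// mulrC ltr_pdivrMr ?ltr0Sn//.
by rewrite -ltr_pdivrMl// mulrC truncnS_gt// divr_ge0 ?ltW.
Qed.

(** * Dedekind completeness, sums of suprema, doubled order-null sequences *)

Definition gaps D : set X :=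
  [set z | exists d u, [/\ D d, ubound D u & z = u - d]].

Lemma infimums_gaps D : D !=set0 -> ubound D !=set0 ->
  infimums (gaps D) 0.
Proof.
move=> [d0 Dd0] [u0 Uu0]; split.
  by move=> _ [d [u [Dd Uu ->]]]; rewrite bl_subr_ge0 Uu.
move=> c lbc.
have Uc n : ubound D (u0 - c *+ n).
  elim: n => [|n IH]; first by rewrite mulr0n subr0.
  move=> d Dd; have /lbc : gaps D (u0 - c *+ n - d)
    by exists d, (u0 - c *+ n).
  by rewrite !bl_lerBrDr mulrS addrA (addrC d).
apply: (@archimedean_le0 _ (u0 - d0)) => n.
by rewrite bl_lerBrDr addrC -bl_lerBrDr; exact: Uc.
Qed.

Hypothesis X_oc : order_continuous_norm X.

(* Gaps [u - d] between upper bounds and elements of [D] decrease to [0], so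
   they become small in norm; elements with small gaps form a Cauchy sequence. *)
Lemma order_continuous_directed_sup D : D !=set0 ->
  (forall x y, D x -> D y -> D (Order.join x y)) ->
  ubound D !=set0 -> supremums D !=set0.
Proof.
move=> D0 DU U0.
have inf0 := infimums_gaps D0 U0.
have [_ inf_norm] : infimums [set `|z| | z in gaps D] (0 : R).
  apply: X_oc => //.
    by case: D0 U0 => d Dd [u Uu]; exists (u - d), d, u.
  move=> _ _ [d [u [Dd Uu ->]]] [d' [u' [Dd' Uu' ->]]].
  exists (Order.meet u u' - Order.join d d').
    exists (Order.join d d'), (Order.meet u u'); split => //; first exact: DU.
    by move=> x Dx; rewrite lexI Uu// Uu'.
  by split; apply: bl_lerD; rewrite ?bl_lerN2 ?leIl ?leIr ?leUl ?leUr.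
have gap n : exists p : X * X,
    [/\ D p.1, ubound D p.2 & `|p.2 - p.1| < n.+1%:R^-1 :> R].
  apply: contrapT => no.
  suff : n.+1%:R^-1 <= 0 :> R by rewrite leNgt invr_gt0 ltr0Sn.
  apply: inf_norm => _ [_ [d [u [Dd Uu ->]]] <-].
  by rewrite leNgt; apply/negP => lt; apply: no; exists (d, u).
have [p pP] := choice gap.
pose d n := (p n).1; pose u n := (p n).2.
(* Every [d] lies below every [u], so both [d m - d n] and its opposite are at most the sum of the
   two gaps. *)
have dist m n : `|d m - d n| <= `|u m - d m| + `|u n - d n|.
  have um k : 0 <= u k - d k.
    by case: (pP k) => Dd Uu _; rewrite bl_subr_ge0; exact: Uu.
  apply: le_trans (ler_normD _ _); apply: le_norm_modulus.
  have Hle k l : d k - d l <= u k - d k + (u l - d l).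
    rewrite -[leLHS]add0r bl_lerD// bl_lerD2r.
    by case: (pP k) => Dd _ _; case: (pP l) => _ Uu _; exact: Uu.
  rewrite (ge0_modulus (x := u m - d m + (u n - d n))); last first.
    by rewrite -[leLHS]addr0; apply: bl_lerD; exact: um.
  by rewrite modulus_le Hle andTb opprB [leRHS]addrC Hle.
have cvgd : cvg (d @ \oo).
  apply/cauchy_cvgP/cauchy_exP => e e0.
  have e20 : 0 < e / 2 by rewrite divr_gt0.
  have [N _ HN] := near_infty_natSinv_lt (PosNum e20).
  exists (d N), N => // n /= Nn; rewrite -ball_normE /=.
  rewrite (le_lt_trans (dist _ _))// (splitr e) ltrD//.
    by case: (pP N) => _ _ /lt_trans; apply; exact: HN (leqnn N).
  by case: (pP n) => _ _ /lt_trans; apply; exact: HN.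
have close (e : R) : 0 < e ->
    exists n, `|d n - lim (d @ \oo)| < e /\ `|u n - d n| < e.
  move=> e0; have /cvgrPdist_lt/(_ _ e0)[N _ HN] := cvgd.
  have [M _ HM] := near_infty_natSinv_lt (PosNum e0).
  exists (maxn N M); split; first by rewrite distrC; apply: HN; exact: leq_maxl.
  by case: (pP (maxn N M)) => _ _ /lt_trans; apply; apply: HM; exact: leq_maxr.
(* For [x] in [D], [x - lim] is at most [(u n - d n) + (d n - lim)]; for an upper bound [y],
   [lim - y] is at most [lim - d n]. Both bounds become small in norm. *)
exists (lim (d @ \oo)); split => [x Dx|y Uy].
  rewrite -(bl_lerD2r (- lim (d @ \oo))) subrr.
  apply: le0_norm_small => e e0.
  have [|n [dn un]] := close (e / 2); first by rewrite divr_gt0.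
  exists ((u n - d n) + (d n - lim (d @ \oo))).
    by rewrite addrA subrK bl_lerD2r; case: (pP n) => _ Uu _; exact: Uu.
  by rewrite (le_lt_trans (ler_normD _ _))// (splitr e) ltrD.
rewrite -(bl_lerD2r (- y)) subrr.
apply: le0_norm_small => e e0.
have [n [dn _]] := close _ e0.
exists (lim (d @ \oo) - d n); last by rewrite distrC.
rewrite bl_lerD// bl_lerN2; case: (pP n) => Dd _ _; exact: Uy.
Qed.

(* The join-closure of [D] is directed and has the same upper bounds as [D]. *)
Lemma order_continuous_sup D : D !=set0 -> ubound D !=set0 ->
  supremums D !=set0.
Proof.
move=> D0 U0.
pose stable := [set E : set X | D `<=` E /\
  forall x y, E x -> E y -> E (Order.join x y)].
pose DU := \bigcap_(E in stable) E.
have subDU : D `<=` DU by move=> x Dx E [DE _]; exact: DE.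
have uboundDU : ubound DU = ubound D.
  apply/seteqP; split=> u uu x; first by move=> Dx; apply: uu; exact: subDU.
  (* The elements below [u] form a join-stable set containing [D], so it contains [DU]. *)
  apply: (_ : DU x -> [set y | y <= u] x); apply; split=> [//|y z /= yu zu].
  by rewrite leUx yu zu.
have : supremums DU !=set0; last by rewrite /supremums uboundDU.
apply: order_continuous_directed_sup; last by rewrite uboundDU.
  exact: subset_nonempty D0.
by move=> x y DUx DUy E sE; apply: sE.2; [exact: DUx | exact: DUy].
Qed.

(** Induction on [n]: with the other choices fixed, the bound passes from the elements of the first
    set to its supremum; the induction hypothesis then applies with bound [B - s ord0]. *)
Lemma sum_supremums_le n (O : 'I_n -> set X) (s : 'I_n -> X) (B : X) :
  (forall i, supremums (O i) (s i)) ->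
  (forall x : 'I_n -> X, (forall i, O i (x i)) -> \sum_i x i <= B) ->
  \sum_i s i <= B.
Proof.
elim: n O s B => [|n IH] O s B Os OB.
  have := OB s; rewrite !big_ord0; apply; by case.
rewrite big_ord_recl addrC -bl_lerBrDr.
apply: (IH (O \o lift ord0)) => [i|x Ox]; first exact: Os.
rewrite bl_lerBrDr addrC -bl_lerBrDr; apply: (Os ord0).2 => x0 Ox0.
rewrite bl_lerBrDr.
have := OB (fun i => if unlift ord0 i is Some j then x j else x0).
rewrite big_ord_recl unlift_none; under eq_bigr do rewrite liftK; apply => i.
by case: unliftP => [j|] ->; [exact: Ox | exact: Ox0].
Qed.

Lemma o_sequence_double (b : nat -> X) :
  o_sequence b -> o_sequence (fun n => b n + b n).
Proof.
move=> [bdec [b0 binf]]; split=> [m n mn|].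
  by apply: bl_lerD; exact: bdec.
split=> [_ [n _ <-]|c lbc].
  by rewrite -[leLHS]addr0; apply: bl_lerD; apply: b0; exists n.
rewrite -(@bl_lerZ2l 2^-1) ?invr_gt0// scaler0.
apply: binf => _ [n _ <-].
rewrite -(@bl_lerZ2l 2) ?ltr0Sn// scalerA mulfV ?pnatr_eq0// scale1r.
by rewrite scaler_nat mulr2n; apply: lbc; exists n.
Qed.

End banach_lattice_order.

(** * Gluing fine partitions of the cells *)

Section henstock_gluing.
Context {R : realType} {T : pmetricType R} {X : banachLatticeType R}.
Variables (mu : {finite_measure set (borel T) -> \bar R}) (f : T -> X).
Variable g : T -> R.
Implicit Types (A E : set T) (P : tagged_family T).

(** Cells must be indexed by an ordinal; [enum_val] allows any finite index type, such as the
    dependent pairs in [glue]. *)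
Definition family_of (I : finType) (c : I -> set T) (t : I -> T) :=
  TaggedFamily (fun i : 'I_#|I| => c (enum_val i)) (fun i => t (enum_val i)).

Definition glue P (Q : 'I_(ncells P) -> tagged_family T) :=
  @family_of {i : 'I_(ncells P) & 'I_(ncells (Q i))}
    (fun p => cell (Q (tag p)) (tagged p))
    (fun p => tag_of (Q (tag p)) (tagged p)).

Lemma riemann_sum_glue P Q :
  riemann_sum mu f (@glue P Q) = \sum_(i < ncells P) riemann_sum mu f (Q i).
Proof.
rewrite /riemann_sum sig_big_dep /= [RHS]big_enum_val.
by apply: eq_bigr.
Qed.

Lemma henstock_partition_glue A P Q : henstock_partition A P ->
  (forall i, henstock_partition (cell P i) (Q i)) ->
  henstock_partition A (@glue P Q).
Proof.
move=> [_ trivP UP _] HQ; split => [i|i j _ _ [x [/= xi xj]]||i] /=.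
- by case: (HQ (tag (enum_val i))).
- apply: enum_val_inj; case: (enum_val i) (enum_val j) xi xj => [a i'] [b j'].
  rewrite /= => xi xj.
  have sub c (k : 'I_(ncells (Q c))) : cell (Q c) k x -> cell P c x.
    by move=> xk; case: (HQ c) => _ _ <- _; exists k.
  (* A common point lies in cells [a] and [b] of [P], which forces [a = b]; only then do the second
     indices belong to the same partition. *)
  have ab : a = b.
    by apply: trivP => //; exists x; split;
      [exact: (sub _ _ xi) | exact: (sub _ _ xj)].
  case: b / ab j' xj => j' xj; congr existT.
  by case: (HQ a) => _ trivQ _ _; apply: trivQ => //; exists x.
- apply/seteqP; split=> [x [i _ xi]|x].
    rewrite -UP; exists (tag (enum_val i)) => //.
    by case: (HQ (tag (enum_val i))) => _ _ <- _; exists (tagged (enum_val i)).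
  rewrite -UP => -[i _]; case: (HQ i) => _ _ <- _ [j _ xj].
  by exists (enum_rank (existT _ i j)); rewrite //= enum_rankK.
- by case: (HQ (tag (enum_val i))).
Qed.

Lemma gage_fine_glue P Q : (forall i, gage_fine g (Q i)) ->
  gage_fine g (@glue P Q).
Proof. by move=> HQ i w; apply: HQ. Qed.

Definition single_cell E (t : T) :=
  TaggedFamily (fun _ : 'I_1 => E) (fun _ => t).

Lemma henstock_partition_single_cell E t : measurable (E : set (borel T)) ->
  E t -> henstock_partition E (single_cell E t).
Proof.
move=> mE Et; split => //= [i j _ _ _|]; first by rewrite !ord1.
by apply/seteqP; split=> [x [_ _ //]|x Ex]; exists ord0.
Qed.

Definition fine_partition E P := henstock_partition E P /\ gage_fine g P.

Definition sum_differences E : set X :=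
  [set x | exists P' P'', [/\ fine_partition E P', fine_partition E P'' &
    x = riemann_sum mu f P'' - riemann_sum mu f P']].

(** The cell with its own tag is a one-cell partition, and it inherits fineness from [P]. *)
Lemma fine_partition_cell P i : fine_partition setT P ->
  exists Q, fine_partition (cell P i) Q.
Proof.
move=> [[mP _ _ tP] fineP]; exists (single_cell (cell P i) (tag_of P i)).
by split; [exact: henstock_partition_single_cell | move=> j w; exact: fineP].
Qed.

Lemma sum_differences0 P i : fine_partition setT P ->
  sum_differences (cell P i) 0.
Proof.
by move=> /(fine_partition_cell i)[Q HQ]; exists Q, Q; rewrite subrr.
Qed.

(* The sets [sum_differences] are symmetric, so passing to moduli does not
   change the upper bounds. *)
Lemma supremums_oscillations E :
  supremums (oscillations mu f g E) = supremums (sum_differences E).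
Proof.
suff ubE : ubound (oscillations mu f g E) = ubound (sum_differences E).
  by rewrite /supremums ubE.
apply/seteqP; split=> u uu _ [P' [P'' [HP' HP'' ->]]].
  by apply: (le_trans (le_modulus _)); apply: uu; exists P', P''.
rewrite modulus_le opprB; apply/andP.
by split; apply: uu; [exists P', P''|exists P'', P'].
Qed.

Lemma le_sum_differences (J B : X) P (x : 'I_(ncells P) -> X) :
  (forall Q, fine_partition setT Q -> modulus (riemann_sum mu f Q - J) <= B) ->
  fine_partition setT P ->
  (forall i, sum_differences (cell P i) (x i)) -> \sum_i x i <= B + B.
Proof.
move=> HJ [HP _] /choice[Q' /choice[Q'' HQ]].
have -> : \sum_i x i = riemann_sum mu f (glue Q'') - riemann_sum mu f (glue Q').
  rewrite !riemann_sum_glue -sumrB; apply: eq_bigr => i _.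
  by case: (HQ i).
have fine_glue Q : (forall i, fine_partition (cell P i) (Q i)) ->
    modulus (riemann_sum mu f (glue Q) - J) <= B.
  move=> fQ; apply: HJ; split.
    by apply: henstock_partition_glue => // i; case: (fQ i).
  by apply: gage_fine_glue => i; case: (fQ i).
(* Inserting [J] between the two glued sums costs [B] for each. *)
rewrite -(subrKA J) -[J - _]opprB; apply: bl_lerD.
  by apply: (le_trans (le_modulus _)); apply: fine_glue => i; case: (HQ i).
apply: (le_trans (le_modulus _)); rewrite modulusN.
by apply: fine_glue => i; case: (HQ i).
Qed.

End henstock_gluing.

Theorem proposition6 (R : realType) (T : pmetricType R)
    (mu : {finite_measure set (borel T) -> \bar R})
    (X : banachLatticeType R) (f : T -> X)
    (T_compact : compact [set: T])
    (mu_regular : regular_measure mu) (mu_nonatomic : nonatomic mu)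
    (X_oc : order_continuous_norm X)
    (f_int : oH_integrable mu f) :
  exists (b : nat -> X) (gamma : nat -> T -> R),
    [/\ o_sequence b,
        forall n, gage (gamma n) &
        forall (n : nat) (P : tagged_family T),
          henstock_partition [set: T] P -> gage_fine (gamma n) P ->
          (forall i, supremums (oscillations mu f (gamma n) (cell P i)) !=set0)
          /\ \sum_(i < ncells P) Ob mu f (gamma n) (cell P i) <= b n].
Proof.
have [J [b [g [bo gg HJ]]]] := f_int.
exists (fun n => b n + b n), g; split; [exact: o_sequence_double|exact: gg|].
move=> n P HP fineP.
have HJn Q : fine_partition (g n) setT Q ->
    modulus (riemann_sum mu f Q - J) <= b n by case; exact: HJ.
have PP : fine_partition (g n) setT P by [].
have sum_le := le_sum_differences HJn PP.
have sup i : supremums (oscillations mu f (g n) (cell P i)) !=set0.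
  rewrite supremums_oscillations; apply: order_continuous_sup => //.
    by exists 0; exact: sum_differences0.
  exists (b n + b n) => y Oy.
  (* Choosing the difference [0] in all other cells bounds the differences over cell [i] alone. *)
  have := sum_le (fun j => if j == i then y else 0).
  rewrite -big_mkcond big_pred1_eq; apply => j.
  by case: eqP => [->//|_]; exact: sum_differences0.
split=> //; apply: (sum_supremums_le
  (O := fun i => sum_differences mu f (g n) (cell P i))) => // i.
rewrite -supremums_oscillations /Ob /supremum.
(* [supremum] takes its default value on the empty set; this case is excluded because comparing a
   fine partition with itself yields the oscillation [modulus 0]. *)
case: eqP => [osc0|_]; last by case: (sup i) => s /xgetI; exact.
have [Q HQ] := fine_partition_cell i PP.
suff : oscillations mu f (g n) (cell P i) (modulus 0) by rewrite osc0.
by exists Q, Q; rewrite subrr.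
Qed.
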